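(* Let $h:\mathbb{Z}_{\ge 0}\to\mathbb{Z}_{\ge 0}$ be nondecreasing and satisfy condition (a): for all $z,z'\in\mathbb{Z}_{\ge0}$ and every positive integer $i$, if $\lfloor z/2^i\rfloor=\lfloor z'/2^i\rfloor$ then $\lfloor h(z)/2^{i-1}\rfloor=\lfloor h(z')/2^{i-1}\rfloor$. Then for all $y,z\in\mathbb{Z}_{\ge0}$ with $y\le h(z)$, the Grundy number of the chocolate bar position $\{y,z\}$ of $CB(h,y,z)$ is $G_h(\{y,z\})=y\oplus z$.
   Context: $\oplus$ denotes nim-sum (bitwise XOR of binary expansions). For a nondecreasing $f:\mathbb{Z}_{\ge0}\to\mathbb{Z}_{\ge0}$ and $y,z\in\mathbb{Z}_{\ge0}$, the chocolate bar $CB(f,y,z)$ has $z+1$ columns, column $0$ being the bitter square, and column $i$ having height $\min(f(i),y)+1$; its position is recorded as $\{y,z\}$ (with $y\le f(z)$, $y$ being the largest height minus one and $z$ the number of columns minus one). The moves are $move_f(\{y,z\})=\{\{v,z\}:v<y\}\cup\{\{\min(y,f(w)),w\}:w<z\}$ ($v,w\in\mathbb{Z}_{\ge0}$). The Grundy number is defined recursively by $G_f(\{y,z\})=\mathrm{mex}\{G_f(p):p\in move_f(\{y,z\})\}$, where mex of a set of nonnegative integers is the least nonnegative integer not in it. *)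

(* Defs.v *)
From Stdlib Require Import Arith List Lia.
Import ListNotations.

(** The pair [(y, z)] stands for the position [{y, z}]: [z] columns besides the
    bitter one, and largest height [y + 1].  Only pairs with [y <= f z] are
    positions of the bar defined by [f]; [moves f] preserves this condition. *)
Definition position : Type := (nat * nat)%type.

(** A horizontal cut lowers [y]; a vertical one leaves [w < z] columns besides
    the bitter one, and then the largest height is at most [f w + 1]. *)
Definition moves (f : nat -> nat) (p : position) : list position :=
  let (y, z) := p in
  map (fun v => (v, z)) (seq 0 y) ++
  map (fun w => (Nat.min y (f w), w)) (seq 0 z).

Lemma in_moves (f : nat -> nat) (y z : nat) (q : position) :
  In q (moves f (y, z)) <->
  (exists v, v < y /\ q = (v, z)) \/
  (exists w, w < z /\ q = (Nat.min y (f w), w)).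
Proof.
  unfold moves. rewrite in_app_iff, !in_map_iff. split.
  - intros [[v [<- Hv]]|[w [<- Hw]]]; rewrite in_seq in *;
      [left; exists v | right; exists w]; split; auto; lia.
  - intros [[v [Hv ->]]|[w [Hw ->]]]; [left; exists v | right; exists w];
      rewrite in_seq; split; auto; lia.
Qed.

Lemma moves_valid (f : nat -> nat) (y z y' z' : nat) :
  y <= f z -> In (y', z') (moves f (y, z)) -> y' <= f z'.
Proof.
  intros Hy [[v [Hv E]]|[w [Hw E]]]%in_moves; injection E; intros; subst; lia.
Qed.

(** The search bound is enough because [0, ..., length l] cannot all lie
    in [l]; see [mex_spec]. *)
Definition mex (l : list nat) : nat :=
  match find (fun n => negb (existsb (Nat.eqb n) l)) (seq 0 (S (length l))) with
  | Some n => n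
  | None => 0
  end.

Lemma find_seq_least (P : nat -> bool) (len start n : nat) :
  find P (seq start len) = Some n ->
  P n = true /\ forall m, start <= m < n -> P m = false.
Proof.
  revert start; induction len as [|len IH]; simpl; [discriminate|].
  intros start; destruct (P start) eqn:E.
  - intros [= <-]; split; [exact E | lia].
  - intros H; destruct (IH _ H) as [H1 H2]; split; [exact H1|].
    intros m Hm; destruct (Nat.eq_dec m start) as [->|]; [exact E|].
    apply H2; lia.
Qed.

Lemma mex_spec (l : list nat) :
  ~ In (mex l) l /\ forall m, m < mex l -> In m l.
Proof.
  assert (B : forall n, negb (existsb (Nat.eqb n) l) = false <-> In n l).
  { intros n; rewrite Bool.negb_false_iff, existsb_exists; split.
    - intros [x [Hx E]]; apply Nat.eqb_eq in E; now subst.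
    - intros H; exists n; split; [exact H | apply Nat.eqb_refl]. }
  unfold mex; destruct (find _ _) as [n|] eqn:E.
  - apply find_seq_least in E; destruct E as [H1 H2]; split.
    + intros H; apply B in H; congruence.
    + intros m Hm; apply B, H2; lia.
  - exfalso.
    assert (I : incl (seq 0 (S (length l))) l).
    { intros n Hn; apply B; exact (find_none _ _ E n Hn). }
    apply NoDup_incl_length in I; [rewrite length_seq in I; lia | apply seq_NoDup].
Qed.

(** Every move decreases [y + z], so [y + z + 1] recursive calls suffice;
    [grundy_eq] is the defining recursion of the Grundy number. *)
Fixpoint grundy_fuel (n : nat) (f : nat -> nat) (p : position) : nat :=
  match n with
  | 0 => 0
  | S n' => mex (map (grundy_fuel n' f) (moves f p))
  end.

Definition grundy (f : nat -> nat) (p : position) : nat :=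
  grundy_fuel (S (fst p + snd p)) f p.

Lemma grundy_fuel_indep (f : nat -> nat) (n m : nat) (p : position) :
  fst p + snd p < n -> fst p + snd p < m ->
  grundy_fuel n f p = grundy_fuel m f p.
Proof.
  revert m p; induction n as [|n IH]; intros m [y z] Hn Hm; [lia|].
  destruct m as [|m]; [lia|].
  cbn [grundy_fuel]; f_equal; apply map_ext_in; intros q Hq.
  apply in_moves in Hq.
  destruct Hq as [[v [Hv ->]]|[w [Hw ->]]]; apply IH; simpl in *; lia.
Qed.

Lemma grundy_eq (f : nat -> nat) (p : position) :
  grundy f p = mex (map (grundy f) (moves f p)).
Proof.
  unfold grundy at 1; cbn [grundy_fuel]; f_equal.
  apply map_ext_in; intros q Hq; destruct p as [y z].
  apply in_moves in Hq.
  destruct Hq as [[v [Hv ->]]|[w [Hw ->]]];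
    apply grundy_fuel_indep; simpl in *; lia.
Qed.

(* Main.v *)
Require Import Defs.
From Stdlib Require Import Arith List Lia.

(** For fixed [y] the map [g w = min y (h w)] inherits condition (a), so the top
    bits of [w] down to position [k + 1] determine those of [g w] down to
    position [k].  Hence the bits of [w] can be recovered from those of
    [g w XOR w], from the top down: [w |-> g w XOR w] permutes every dyadic
    block.  Injectivity shows that no move of [{y, z}] has value [y XOR z], and
    surjectivity on the block cut out by the highest bit at which
    [m < y XOR z] differs from [y XOR z] yields a move of value [m]. *)

(** Condition (a) at [i = S k], in shift form so that no truncated [i - 1] occurs and the bitwise
    lemmas apply. *)
Definition dyadic_lag (g : nat -> nat) : Prop :=
  forall z z' k : nat, Nat.shiftr z (S k) = Nat.shiftr z' (S k) ->
    Nat.shiftr (g z) k = Nat.shiftr (g z') k.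

Lemma lxor_cancel_l (a b c : nat) : Nat.lxor a b = Nat.lxor a c -> b = c.
Proof.
  intros H. apply (f_equal (Nat.lxor a)) in H.
  now rewrite <- !Nat.lxor_assoc, !Nat.lxor_nilpotent, !Nat.lxor_0_l in H.
Qed.

Lemma lxor_cancel_r (a b c : nat) : Nat.lxor b a = Nat.lxor c a -> b = c.
Proof. rewrite !(Nat.lxor_comm _ a). apply lxor_cancel_l. Qed.

Lemma odd_lxor (a b : nat) : Nat.odd (Nat.lxor a b) = xorb (Nat.odd a) (Nat.odd b).
Proof. rewrite <- !Nat.bit0_odd. apply Nat.lxor_spec. Qed.

Lemma div2_lxor (a b : nat) :
  Nat.div2 (Nat.lxor a b) = Nat.lxor (Nat.div2 a) (Nat.div2 b).
Proof. exact (Nat.shiftr_lxor a b 1). Qed.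

Lemma eq_of_div2_odd (a b : nat) :
  Nat.div2 a = Nat.div2 b -> Nat.odd a = Nat.odd b -> a = b.
Proof.
  intros H1 H2. rewrite (Nat.div2_odd a), (Nat.div2_odd b). now rewrite H1, H2.
Qed.

Lemma div2_eq_cases (a b : nat) :
  Nat.div2 a = Nat.div2 b -> a = b \/ a = Nat.lxor b 1.
Proof.
  intros H. destruct (Bool.bool_dec (Nat.odd a) (Nat.odd b)) as [E|E].
  - left. now apply eq_of_div2_odd.
  - right. apply eq_of_div2_odd.
    + rewrite div2_lxor. simpl. now rewrite Nat.lxor_0_r.
    + revert E. rewrite odd_lxor. destruct (Nat.odd a), (Nat.odd b); simpl; intuition congruence.
Qed.

Lemma shiftr_le_mono (a b k : nat) : a <= b -> Nat.shiftr a k <= Nat.shiftr b k.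
Proof.
  intros H. rewrite !Nat.shiftr_div_pow2. now apply Nat.Div0.div_le_mono.
Qed.

Lemma shiftr_min (a b k : nat) :
  Nat.shiftr (Nat.min a b) k = Nat.min (Nat.shiftr a k) (Nat.shiftr b k).
Proof.
  destruct (Nat.le_ge_cases a b) as [H|H];
    pose proof (shiftr_le_mono _ _ k H);
    [rewrite !Nat.min_l | rewrite !Nat.min_r]; trivial.
Qed.

Lemma shiftr_small (a k : nat) : a < 2 ^ k -> Nat.shiftr a k = 0.
Proof. intros H. rewrite Nat.shiftr_div_pow2. now apply Nat.div_small. Qed.

(** Descent from a shift that kills both numbers: each step down either keeps the shifts equal or
    exposes a flipped lowest bit. *)
Lemma highest_differing_bit (a b : nat) :
  a <> b -> exists k, Nat.shiftr a (S k) = Nat.shiftr b (S k) /\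
                      Nat.shiftr a k = Nat.lxor (Nat.shiftr b k) 1.
Proof.
  intros Hab.
  assert (top : Nat.shiftr a (a + b) = Nat.shiftr b (a + b)).
  { rewrite !shiftr_small; trivial;
      apply Nat.le_lt_trans with (a + b); try lia; apply Nat.pow_gt_lin_r; lia. }
  induction (a + b) as [|k IH]; [now elim Hab|].
  destruct (div2_eq_cases _ _ top) as [E|E]; [now apply IH|].
  now exists k.
Qed.

(** The two shifts differ only in their lowest bit, so they are consecutive numbers and that bit
    alone decides the order. *)
Lemma shiftr_flip_lt (a b k : nat) :
  Nat.shiftr a k = Nat.lxor (Nat.shiftr b k) 1 ->
  (a < b <-> Nat.odd (Nat.shiftr b k) = true).
Proof.
  intros E.
  assert (E2 : Nat.div2 (Nat.shiftr a k) = Nat.div2 (Nat.shiftr b k)).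
  { rewrite E, div2_lxor. apply Nat.lxor_0_r. }
  assert (Eo : Nat.odd (Nat.shiftr a k) = negb (Nat.odd (Nat.shiftr b k))).
  { rewrite E, odd_lxor. now destruct (Nat.odd (Nat.shiftr b k)). }
  pose proof (Nat.div2_odd (Nat.shiftr a k)) as Da.
  pose proof (Nat.div2_odd (Nat.shiftr b k)) as Db.
  rewrite Eo, E2 in Da.
  pose proof (shiftr_le_mono a b k). pose proof (shiftr_le_mono b a k).
  destruct (Nat.odd (Nat.shiftr b k)); simpl in Da, Db; split; intros;
    try discriminate; trivial; lia.
Qed.

(** At the highest bit [k] where [w] and [z] differ, [g w] and [g z] still agree from bit [k] up;
    cancelling them leaves equal bits of [w] and [z] at [k]. *)
Lemma lag_lxor_inj (g : nat -> nat) (w z : nat) :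
  dyadic_lag g -> Nat.lxor (g w) w = Nat.lxor (g z) z -> w = z.
Proof.
  intros Hg E. destruct (Nat.eq_dec w z) as [|N]; trivial.
  destruct (highest_differing_bit _ _ N) as [k [E1 E2]].
  apply (f_equal (fun n => Nat.shiftr n k)) in E.
  rewrite !Nat.shiftr_lxor, (Hg _ _ _ E1) in E. apply lxor_cancel_l in E.
  rewrite E in E2. apply (f_equal Nat.odd) in E2. rewrite odd_lxor in E2.
  now destruct (Nat.odd (Nat.shiftr z k)).
Qed.

Lemma lag_lxor_surj_block (g : nat -> nat) (k z m : nat) :
  dyadic_lag g -> Nat.shiftr m k = Nat.shiftr (Nat.lxor (g z) z) k ->
  exists w, Nat.shiftr w k = Nat.shiftr z k /\ Nat.lxor (g w) w = m.
Proof.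
  intros Hg. revert z. induction k as [|k IH]; intros z E.
  - now exists z.
  - destruct (div2_eq_cases (Nat.shiftr m k) (Nat.shiftr _ k) E) as [E'|E'].
    + destruct (IH _ E') as [w [Hw Hm]]. exists w. split; trivial.
      simpl. now rewrite Hw.
    (* Bit [k] of the value is wrong. Flipping bit [k] of [z] corrects it, because [g] is unchanged
       from bit [k] up. *)
    + set (z' := Nat.lxor z (2 ^ k)).
      assert (Hz : Nat.shiftr z' k = Nat.lxor (Nat.shiftr z k) 1).
      { unfold z'. rewrite Nat.shiftr_lxor. f_equal.
        rewrite Nat.shiftr_div_pow2. apply Nat.div_same, Nat.pow_nonzero. lia. }
      assert (Hz' : Nat.shiftr z' (S k) = Nat.shiftr z (S k)).
      { simpl. rewrite Hz, div2_lxor. apply Nat.lxor_0_r. }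
      destruct (IH z') as [w [Hw Hm]].
      { now rewrite E', !Nat.shiftr_lxor, Hz, (Hg _ _ _ Hz'), Nat.lxor_assoc. }
      exists w. split; trivial. rewrite <- Hz'. simpl. now rewrite Hw.
Qed.

Lemma mex_unique (l : list nat) (n : nat) :
  ~ In n l -> (forall m, m < n -> In m l) -> mex l = n.
Proof.
  intros H1 H2. destruct (mex_spec l) as [M1 M2].
  destruct (Nat.lt_trichotomy (mex l) n) as [L|[E|L]]; trivial.
  - now elim M1; apply H2.
  - now elim H1; apply M2.
Qed.

Theorem mainTheorem1
  (h : nat -> nat)
  (h_nondecreasing : forall a b : nat, a <= b -> h a <= h b)
  (h_cond : forall z z' i : nat, 0 < i ->
     z / 2 ^ i = z' / 2 ^ i -> h z / 2 ^ (i - 1) = h z' / 2 ^ (i - 1))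
  (y z : nat) (hyz : y <= h z) :
  grundy h (y, z) = Nat.lxor y z.
Proof.
  remember (y + z) as s eqn:Hs. revert y z hyz Hs.
  induction s as [s IH] using lt_wf_ind. intros y z hyz ->.
  set (g := fun w => Nat.min y (h w)).
  assert (Hg : dyadic_lag g).
  { intros a b k E. unfold g. rewrite !shiftr_min. f_equal.
    rewrite !Nat.shiftr_div_pow2 in *.
    replace k with (S k - 1) by lia. apply h_cond; trivial; lia. }
  (* Hence [y XOR z] is itself the value of [w |-> g w XOR w] at [z]. *)
  assert (gz : g z = y) by (unfold g; lia).
  assert (Gv : forall v, v < y -> grundy h (v, z) = Nat.lxor v z).
  { intros v Hv. apply (IH (v + z)); trivial; lia. }
  assert (Gw : forall w, w < z -> grundy h (g w, w) = Nat.lxor (g w) w).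
  { intros w Hw. apply (IH (g w + w)); trivial; unfold g; lia. }
  rewrite grundy_eq. apply mex_unique.
  - intros [q [Eq Hq]]%in_map_iff.
    apply in_moves in Hq as [[v [Hv ->]]|[w [Hw ->]]].
    + rewrite Gv in Eq by trivial. apply lxor_cancel_r in Eq. lia.
    + change (grundy h (g w, w) = Nat.lxor y z) in Eq.
      rewrite Gw, <- gz in Eq by trivial.
      apply lag_lxor_inj in Eq; trivial. lia.
  - intros m Hm.
    destruct (highest_differing_bit m (Nat.lxor y z)) as [k [E1 E2]]; [lia|].
    apply (shiftr_flip_lt _ _ _ E2) in Hm.
    rewrite Nat.shiftr_lxor in E2, Hm. rewrite odd_lxor in Hm.
    apply in_map_iff.
    (* By [Hm] exactly one of [y] and [z] has bit [k] set. If it is [y], a horizontal cut to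
       [m XOR z] reaches [m]; otherwise a vertical cut does. *)
    destruct (Nat.odd (Nat.shiftr y k)) eqn:Oy.
    + set (v := Nat.lxor m z).
      assert (Hv : v < y).
      { apply (shiftr_flip_lt _ _ k); trivial.
        unfold v. rewrite Nat.shiftr_lxor, E2.
        rewrite (Nat.lxor_assoc _ _ 1), (Nat.lxor_comm _ 1), <- Nat.lxor_assoc.
        now rewrite Nat.lxor_assoc, Nat.lxor_nilpotent, Nat.lxor_0_r. }
      exists (v, z). split.
      * rewrite Gv by trivial. unfold v.
        now rewrite Nat.lxor_assoc, Nat.lxor_nilpotent, Nat.lxor_0_r.
      * apply in_moves. left. now exists v.
    + destruct (lag_lxor_surj_block g (S k) z m Hg) as [w [Ew Em]].
      { now rewrite gz. }
      (* [w] agrees with [z] above bit [k], so [g w] agrees with [y] from bit [k] up. The flip at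
         bit [k] therefore falls on [w], and [z] has a 1 there. *)
      assert (Hw : w < z).
      { apply (shiftr_flip_lt _ _ k); trivial.
        rewrite <- Em, Nat.shiftr_lxor, (Hg _ _ _ Ew), gz, Nat.lxor_assoc in E2.
        now apply lxor_cancel_l in E2. }
      exists (g w, w). split.
      * now rewrite Gw.
      * apply in_moves. right. now exists w.
Qed.
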